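(* Let $L, W$ be subsets of a metric space. If at least one of $L, W$ is totally bounded, then the ambient Čech persistence module $\mathrm{H}(\check{\mathbb{C}}\mathrm{ech}(L,W))$ is q-tame.
   Context: Fix a field $\mathbf{k}$; $\mathrm{H}$ denotes (total) simplicial homology with coefficients in $\mathbf{k}$. A persistence module $\mathbb{V}$ is a family of $\mathbf{k}$-vector spaces $(V_a)_{a\in\mathbf{R}}$ with linear maps $v_a^b:V_a\to V_b$ for $a\le b$ such that $v_a^a=\mathrm{id}$ and $v_b^c\circ v_a^b=v_a^c$ for $a\le b\le c$. It is q-tame if $\mathrm{rank}(v_a^b)<\infty$ whenever $a<b$. A metric space is totally bounded if for every $\varepsilon>0$ it has a finite subset $F$ such that every point is at distance $<\varepsilon$ from some point of $F$. For subsets $L,W$ of a metric space with metric $d$ and $a\in\mathbf{R}$, $\check{\mathrm{C}}\mathrm{ech}(L,W;a)$ is the simplicial complex whose simplices are the nonempty finite subsets $\sigma\subseteq L$ for which there exists $w\in W$ with $d(w,l)\le a$ for all $l\in\sigma$. $\mathrm{H}(\check{\mathbb{C}}\mathrm{ech}(L,W))$ is the persistence module $(\mathrm{H}(\check{\mathrm{C}}\mathrm{ech}(L,W;a)))_{a\in\mathbf{R}}$ with maps induced by inclusions. *)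

(* Defs.v *)
From HB Require Import structures.
From mathcomp Require Import all_boot all_order all_algebra.
From mathcomp Require Import generic_quotient ring_quotient.
From mathcomp Require Import finmap monalg.
From mathcomp Require Import all_classical all_reals all_analysis wochoice.

Set Implicit Arguments.
Unset Strict Implicit.
Unset Printing Implicit Defensive.

Import Order.TTheory GRing.Theory Num.Theory.

Local Open Scope classical_set_scope.
Local Open Scope ring_scope.

Definition finite_rank (k : fieldType) (U V : lmodType k)
    (f : {linear U -> V}) : Prop :=
  exists s : seq U, forall x : U, exists c : 'I_(size s) -> k,
    f x = \sum_(i < size s) c i *: f s`_i.

Record persistence_module (R : realType) (k : fieldType) := PersistenceModule {
  pm_space :> R -> lmodType k;
  pm_map : forall a b : R, a <= b -> {linear pm_space a -> pm_space b};
  pm_map_id : forall (a : R) (h : a <= a) x, pm_map h x = x;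
  pm_map_comp : forall (a b c : R) (hab : a <= b) (hbc : b <= c) (hac : a <= c) x,
    pm_map hbc (pm_map hab x) = pm_map hac x
}.

Arguments pm_map {R k} p {a b}.

Definition q_tame (R : realType) (k : fieldType)
    (V : persistence_module R k) : Prop :=
  forall (a b : R) (h : a < b), finite_rank (pm_map V (ltW h)).

Definition totally_bounded (R : realType) (X : metricType R) (A : set X) : Prop :=
  forall e : R, 0 < e -> exists F : set X,
    [/\ finite_set F, F `<=` A &
        forall x, A x -> exists2 y, F y & mdist x y < e].

Record simplicial_complex (T : choiceType) := SimplicialComplex {
  simplices : set {fset T};
  simplex_neq0 : forall s, simplices s -> s != fset0;
  simplex_face : forall s t, simplices s -> (t `<=` s)%fset -> t != fset0 ->
    simplices t
}.

(* Simplices are oriented by one fixed total order on the ambient set of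
   potential vertices, so that the chains of a subcomplex are chains of the
   complex. Up to isomorphism homology does not depend on this order. *)
Definition vertex_le (T : choiceType) : rel T := projT1 (well_ordering_principle T).

Lemma vertex_le_total_order (T : choiceType) : total_order (@vertex_le T).
Proof.
have wo : wo_chain (@vertex_le T) predT.
  by move=> A _; apply: (projT2 (well_ordering_principle T)).
have tot : total (@vertex_le T) by move=> x y; apply: (wo_chainW wo).
have refl : reflexive (@vertex_le T) by move=> x; apply: (wo_chain_reflexive wo).
have anti : antisymmetric (@vertex_le T).
  by move=> x y; apply: (wo_chain_antisymmetric wo).
split => //; split => //; split => // y x z xy yz.
have [|m [[/or3P mxyz minm] _]] :=
  projT2 (well_ordering_principle T) [pred u | [|| u == x, u == y | u == z]].
  by exists x; rewrite !inE eqxx.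
have lx : vertex_le m x by apply: minm; rewrite !inE eqxx.
have ly : vertex_le m y by apply: minm; rewrite !inE eqxx orbT.
have lz : vertex_le m z by apply: minm; rewrite !inE eqxx !orbT.
case: mxyz => /eqP E; rewrite {}E in lx ly lz => //.
- by rewrite (anti x y) // xy lx.
- by rewrite -(anti y z) // yz ly.
Qed.

Section Homology.
Variables (k : fieldType) (T : choiceType).
Implicit Types (s t : {fset T}) (v w : T) (K : simplicial_complex T).

Definition vertex_lt v w := (v != w) && vertex_le v w.

(* The index i of v in s = {v_0 < ... < v_n}. *)
Definition position s v : nat := #|` [fset w in s | vertex_lt w v]%fset|.

(* \sum_i (-1)^i [v_0, ..., v_(i-1), v_(i+1), ..., v_n] for
   s = {v_0 < ... < v_n}; the guard discards the empty face of a vertex. *)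
Definition simplex_boundary s : {malg k[{fset T}]} :=
  \sum_(v <- s | (s `\ v)%fset != fset0)
     << (-1) ^+ position s v *g (s `\ v)%fset >>.

(* Chains of all dimensions at once: the free vector space on the nonempty
   finite sets of vertices, with its homogeneous differential of degree -1. *)
Definition boundary (c : {malg k[{fset T}]}) : {malg k[{fset T}]} :=
  \sum_(s <- msupp c) c@_s *: simplex_boundary s.

Lemma boundaryEw (d : {fset {fset T}}) (c : {malg k[{fset T}]}) :
  (msupp c `<=` d)%fset -> boundary c = \sum_(s <- d) c@_s *: simplex_boundary s.
Proof.
move=> cd; rewrite /boundary (big_fset_incl _ cd) //= => s _.
by move/mcoeff_outdom => ->; rewrite scale0r.
Qed.

Lemma boundary_is_linear : linear boundary.
Proof.
move=> a c1 c2; pose d := (msupp c1 `|` msupp c2)%fset.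
have d1 : (msupp c1 `<=` d)%fset by apply: fsubsetUl.
have d2 : (msupp c2 `<=` d)%fset by apply: fsubsetUr.
have d3 : (msupp (a *: c1 + c2) `<=` d)%fset.
  apply: fsubset_trans (msuppD_le _ _) _; rewrite fsubUset d2 andbT.
  exact: fsubset_trans (msuppZ_le _ _) d1.
rewrite (boundaryEw d1) (boundaryEw d2) (boundaryEw d3) scaler_sumr -big_split.
by apply: eq_bigr => s _; rewrite mcoeffD mcoeffZ scalerDl scalerA.
Qed.

HB.instance Definition _ :=
  GRing.isLinear.Build k {malg k[{fset T}]} {malg k[{fset T}]} _ boundary
    boundary_is_linear.

Lemma boundaryU a s : boundary << a *g s >> = a *: simplex_boundary s.
Proof.
by rewrite (boundaryEw (@msuppU_le _ _ s a)) big_seq_fset1 mcoeffUU.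
Qed.

Lemma position_lt s v w : v \in s -> vertex_lt v w ->
  position s w = (position (s `\ v)%fset w).+1.
Proof.
move=> vs vw; rewrite /position (cardfsD1 v) !inE vs vw /= add1n; congr _.+1.
congr #|` _|; apply/fsetP => u; rewrite !inE /=.
by case: (u != v); case: (u \in s).
Qed.

Lemma position_gt s v w : vertex_lt v w ->
  position (s `\ w)%fset v = position s v.
Proof.
move=> vw; rewrite /position; congr #|` _|; apply/fsetP => u; rewrite !inE /=.
case: eqP => //= ->; case: (w \in s) => //=; apply/esym/negP => /andP[_ wv].
move: vw => /andP[/eqP nvw vw]; apply: nvw.
by apply: (vertex_le_total_order T).1.2; rewrite vw wv.
Qed.

Lemma boundary_simplex_boundary s : boundary (simplex_boundary s) = 0.
Proof.
pose F v w : {malg k[{fset T}]} :=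
  << (-1) ^+ (position s v + position (s `\ v)%fset w) *g (s `\ v `\ w)%fset >>.
pose P v w := (v != w) && ((s `\ v `\ w)%fset != fset0).
have -> : boundary (simplex_boundary s) = \sum_(v <- s) \sum_(w <- s | P v w) F v w.
  rewrite /simplex_boundary linear_sum /= big_mkcond; apply: eq_bigr => v _.
  rewrite boundaryU scaler_sumr.
  have -> : \sum_(w <- s | P v w) F v w =
      \sum_(w <- (s `\ v)%fset | (s `\ v `\ w)%fset != fset0) F v w.
    have sv : (s `\ v `<=` s)%fset by apply: fsubD1set.
    rewrite [LHS]big_mkcond [RHS]big_mkcond -(big_fset_incl _ sv) /=.
      apply: eq_big_seq => w; rewrite !inE /P => /andP[wv _].
      by rewrite eq_sym wv.
    by move=> w ws; rewrite !inE ws andbT negbK => /eqP ->; rewrite /P eqxx.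
  case: ifP => [_|/negbFE/eqP ->]; last by rewrite big_nil.
  by apply: eq_bigr => w _; apply/malgP => t; rewrite mcoeffZ !mcoeffU exprD mulrnAr.
have split_lt v w : P v w = P v w && vertex_lt v w (+) P v w && vertex_lt w v.
  rewrite /P /vertex_lt; case: eqVneq => //= nvw.
  case: (_ != _) => //=.
  have := (vertex_le_total_order T).2 v w.
  case vw: (vertex_le v w); case wv: (vertex_le w v) => //= _.
  by case/eqP: nvw; apply: (vertex_le_total_order T).1.2; rewrite vw wv.
have -> : \sum_(v <- s) \sum_(w <- s | P v w) F v w =
    \sum_(v <- s) \sum_(w <- s | P v w && vertex_lt v w) F v w +
    \sum_(v <- s) \sum_(w <- s | P v w && vertex_lt w v) F v w.
  rewrite -big_split /=; apply: eq_bigr => v _.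
  rewrite [LHS]big_mkcond [X in X + _]big_mkcond [X in _ + X]big_mkcond -big_split.
  apply: eq_bigr => w _ /=; have := split_lt v w.
  by case: (P v w) => //=; case: (vertex_lt v w); case: (vertex_lt w v) => //=;
    rewrite ?addr0 ?add0r.
rewrite [X in _ + X](exchange_big_dep xpredT) //= -big_split /=.
apply: big1_seq => v /= vs.
have PC w : P w v = P v w.
  rewrite /P eq_sym; congr (_ && (_ != _)); apply/fsetP => u; rewrite !inE.
  by rewrite andbCA.
under [X in _ + X]eq_bigl => w do rewrite PC.
rewrite -big_split /= big_seq_cond; apply: big1 => w /andP[ws /andP[_ vw]].
have E : (s `\ w `\ v = s `\ v `\ w)%fset.
  by apply/fsetP => u; rewrite !inE andbCA.
rewrite /F E -monalgUD (position_lt vs vw) (position_gt _ vw) addSn addnC exprS.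
by rewrite mulN1r subrr monalgU0.
Qed.

Lemma boundary_boundary c : boundary (boundary c) = 0.
Proof.
rewrite {2}/boundary linear_sum big1 // => s _.
by rewrite linearZ /= boundary_simplex_boundary scaler0.
Qed.

(* The free vector space on the simplices of K. *)
Definition chain K : {pred {malg k[{fset T}]}} :=
  fun c => `[< forall s, s \in msupp c -> simplices K s >].

Definition cycle K : {pred {malg k[{fset T}]}} :=
  fun c => (c \in chain K) && (boundary c == 0).

Lemma chainP K c : reflect (forall s, s \in msupp c -> simplices K s) (c \in chain K).
Proof. exact: asboolP. Qed.

Lemma chain_submod_closed K : subsemimod_closed (chain K).
Proof.
split; first split.
- by apply/chainP => s; rewrite msupp0.
- move=> c1 c2 /chainP h1 /chainP h2; apply/chainP => s.
  by move=> /(fsubsetP (msuppD_le _ _)); rewrite inE => /orP[/h1|/h2].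
- move=> a c /chainP h; apply/chainP => s.
  by move=> /(fsubsetP (msuppZ_le _ _)) /h.
Qed.

HB.instance Definition _ K :=
  GRing.isSubmodClosed.Build k {malg k[{fset T}]} (chain K) (chain_submod_closed K).

Lemma boundary_chain K c : c \in chain K -> boundary c \in chain K.
Proof.
move=> /chainP cK; rewrite /boundary big_seq; apply: rpred_sum => s /cK Ks.
apply: rpredZ; rewrite /simplex_boundary big_seq_cond; apply: rpred_sum => v.
move=> /andP[vs n0]; apply/chainP => t /(fsubsetP msuppU_le).
by rewrite inE => /eqP ->; apply: simplex_face Ks _ n0; apply: fsubD1set.
Qed.

Lemma cycle_submod_closed K : subsemimod_closed (cycle K).
Proof.
split; first split.
- by rewrite unfold_in rpred0 linear0 eqxx.
- move=> c1 c2 /andP[h1 /eqP e1] /andP[h2 /eqP e2].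
  by rewrite unfold_in rpredD //= linearD /= e1 e2 addr0.
- move=> a c /andP[h /eqP e]; rewrite unfold_in rpredZ //= linearZ /= e.
  by rewrite scaler0.
Qed.

HB.instance Definition _ K :=
  GRing.isSubmodClosed.Build k {malg k[{fset T}]} (cycle K) (cycle_submod_closed K).

Record cycles K := Cycle {cycle_val : {malg k[{fset T}]}; _ : cycle_val \in cycle K}.

HB.instance Definition _ K := [isSub for @cycle_val K].
HB.instance Definition _ K := [Choice of cycles K by <:].
HB.instance Definition _ K := [SubChoice_isSubLmodule of cycles K by <:].

Definition boundaries K : {pred cycles K} :=
  fun z => `[< exists2 c, c \in chain K & boundary c = val z >].

Arguments boundaries K : clear implicits.

Lemma boundariesP K (z : cycles K) :
  reflect (exists2 c, c \in chain K & boundary c = val z) (z \in boundaries K).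
Proof. exact: asboolP. Qed.

Lemma boundaries_submod_closed K : subsemimod_closed (boundaries K).
Proof.
split; first split.
- by apply/boundariesP; exists 0; rewrite ?rpred0 ?linear0.
- move=> z1 z2 /boundariesP[c1 h1 e1] /boundariesP[c2 h2 e2].
  by apply/boundariesP; exists (c1 + c2); rewrite ?rpredD // !linearD /= e1 e2.
- move=> a z /boundariesP[c h e]; apply/boundariesP; exists (a *: c).
    exact: rpredZ.
  by rewrite !linearZ /= e.
Qed.

HB.instance Definition _ K :=
  GRing.isSubmodClosed.Build k (cycles K) (boundaries K) (boundaries_submod_closed K).

(* Since the differential is homogeneous, ker / im on chains of all dimensions
   is the direct sum of the homology groups H_n, n >= 0. *)
Definition homology K := @Quotient.quot (cycles K) (boundaries K).

HB.instance Definition _ K := GRing.Zmodule.on (homology K).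

Definition homology_class K (z : cycles K) : homology K := (\pi_(homology K) z)%qT.

Lemma homology_classP K (z1 z2 : cycles K) :
  homology_class z1 = homology_class z2 <-> z1 - z2 \in boundaries K.
Proof.
rewrite /homology_class; split => [h|h].
  by rewrite Quotient.idealrBE; apply/eqP.
by apply/eqP; rewrite -Quotient.idealrBE.
Qed.

Lemma homology_class_repr K (x : homology K) : homology_class (repr x) = x.
Proof. exact: reprK. Qed.

Lemma repr_homology_class K (z : cycles K) :
  repr (homology_class z) - z \in boundaries K.
Proof. by apply/homology_classP; rewrite homology_class_repr. Qed.

Lemma homology_class_is_zmod_morphism K : zmod_morphism (@homology_class K).
Proof. by move=> x y; rewrite /homology_class !piE. Qed.

HB.instance Definition _ K := GRing.isZmodMorphism.Build (cycles K) (homology K)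
  (@homology_class K) (@homology_class_is_zmod_morphism K).

Definition homology_scale K (a : k) (x : homology K) : homology K :=
  homology_class (a *: repr x).

Lemma homology_scaleE K a (z : cycles K) :
  homology_scale a (homology_class z) = homology_class (a *: z).
Proof.
by apply/homology_classP; rewrite -scalerBr rpredZ // repr_homology_class.
Qed.

Lemma homology_scaleA K a b (x : homology K) :
  homology_scale a (homology_scale b x) = homology_scale (a * b) x.
Proof. by rewrite -(homology_class_repr x) !homology_scaleE scalerA. Qed.

Lemma homology_scale1 K : left_id 1 (@homology_scale K).
Proof. by move=> x; rewrite -(homology_class_repr x) homology_scaleE scale1r. Qed.

Lemma homology_scaleDr K : right_distributive (@homology_scale K) +%R.
Proof.
move=> a x y; rewrite -(homology_class_repr x) -(homology_class_repr y) -raddfD.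
by rewrite !homology_scaleE scalerDr raddfD.
Qed.

Lemma homology_scaleDl K (x : homology K) :
  {morph (@homology_scale K)^~ x : a b / a + b}.
Proof.
by move=> a b; rewrite -(homology_class_repr x) !homology_scaleE scalerDl raddfD.
Qed.

HB.instance Definition _ K := GRing.Zmodule_isLmodule.Build k (homology K)
  (@homology_scaleA K) (@homology_scale1 K) (@homology_scaleDr K)
  (@homology_scaleDl K).

Lemma homology_class_is_linear K : linear (@homology_class K).
Proof. by move=> a x y; rewrite raddfD /= -homology_scaleE. Qed.

HB.instance Definition _ K := GRing.isLinear.Build k (cycles K) (homology K) _
  (@homology_class K) (@homology_class_is_linear K).

Section Inclusion.
Variables (K K' : simplicial_complex T) (sKK' : simplices K `<=` simplices K').

Lemma chain_incl c : c \in chain K -> c \in chain K'.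
Proof. by move=> /chainP h; apply/chainP => s /h /sKK'. Qed.

Lemma cycle_incl_subproof (z : cycles K) : val z \in cycle K'.
Proof.
by have /andP[h e] := valP z; rewrite unfold_in e andbT chain_incl.
Qed.

Definition cycle_incl (z : cycles K) : cycles K' := Cycle (cycle_incl_subproof z).

Definition homology_incl (x : homology K) : homology K' :=
  homology_class (cycle_incl (repr x)).

Lemma homology_inclE (z : cycles K) :
  homology_incl (homology_class z) = homology_class (cycle_incl z).
Proof.
apply/homology_classP/boundariesP.
have /boundariesP[c h e] := repr_homology_class z.
by exists c; [exact: chain_incl | rewrite e !linearB].
Qed.

Lemma homology_incl_is_linear : linear homology_incl.
Proof.
move=> a x y; rewrite -(homology_class_repr x) -(homology_class_repr y).
rewrite -homology_class_is_linear !homology_inclE -homology_class_is_linear.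
congr homology_class.
by apply: val_inj.
Qed.

HB.instance Definition _ := GRing.isLinear.Build k (homology K) (homology K') _
  homology_incl homology_incl_is_linear.

End Inclusion.

End Homology.

Arguments boundaries {k T} K.
Arguments homology k {T} K.
Arguments homology_incl k {T K K'} sKK'.

Record filtration (R : realType) (T : choiceType) := Filtration {
  filtration_complex :> R -> simplicial_complex T;
  filtration_incl : forall a b : R, a <= b ->
    simplices (filtration_complex a) `<=` simplices (filtration_complex b)
}.

Arguments filtration_incl {R T} f {a b}.

Section PersistentHomology.
Variables (R : realType) (k : fieldType) (T : choiceType) (F : filtration R T).

Definition persistent_map (a b : R) (h : a <= b) :
    {linear homology k (F a) -> homology k (F b)} :=
  homology_incl k (filtration_incl F h).

Lemma persistent_map_id (a : R) (h : a <= a) x : persistent_map h x = x.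
Proof.
rewrite -(homology_class_repr x) /= homology_inclE; congr homology_class.
exact: val_inj.
Qed.

Lemma persistent_map_comp (a b c : R) (hab : a <= b) (hbc : b <= c)
    (hac : a <= c) x :
  persistent_map hbc (persistent_map hab x) = persistent_map hac x.
Proof.
rewrite -(homology_class_repr x) /= !homology_inclE; congr homology_class.
exact: val_inj.
Qed.

Definition persistent_homology : persistence_module R k :=
  PersistenceModule persistent_map_id persistent_map_comp.

End PersistentHomology.

Section Cech.
Variables (R : realType) (X : metricType R) (L W : set X).

Definition cech_simplices (a : R) : set {fset X} :=
  [set s | [/\ s != fset0, forall l, l \in s -> L l &
               exists2 w, W w & forall l, l \in s -> mdist w l <= a]].

Lemma cech_neq0 a s : cech_simplices a s -> s != fset0.
Proof. by case. Qed.

Lemma cech_face a s t : cech_simplices a s -> (t `<=` s)%fset -> t != fset0 ->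
  cech_simplices a t.
Proof.
move=> [_ sL [w Ww ws]] /fsubsetP ts t0; split => // [l /ts/sL //|].
by exists w => // l /ts/ws.
Qed.

Definition cech_complex (a : R) : simplicial_complex X :=
  SimplicialComplex (@cech_neq0 a) (@cech_face a).

Lemma cech_incl a b : a <= b -> simplices (cech_complex a) `<=` simplices (cech_complex b).
Proof.
move=> ab s [s0 sL [w Ww ws]]; split => //; exists w => // l /ws wl.
exact: le_trans wl ab.
Qed.

Definition cech_filtration : filtration R X := Filtration cech_incl.

End Cech.

Definition cech_persistence (R : realType) (k : fieldType) (X : metricType R)
    (L W : set X) : persistence_module R k :=
  persistent_homology k (cech_filtration L W).

(* Main.v *)
Require Import Defs.
From HB Require Import structures.
From mathcomp Require Import all_boot all_order all_algebra finmap monalg.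
From mathcomp Require Import all_classical all_reals all_analysis.

(** The inclusion of Čech complexes at parameters a < b is contiguous to a map
    with finite image, and such an inclusion has finite rank on homology.

    Finite rank comes from a general fact, [finite_rank_contiguous]. Let K be a
    subcomplex of K', and let r be a map on vertices that sends the vertices of K
    into a finite set G and such that s `|` r @` s is a simplex of K' for every
    simplex s of K. The maps induced by r and by the inclusion are then chain
    homotopic, so a cycle of K whose image under r vanishes bounds in K'. That
    image lives in the finite-dimensional space of chains on the subsets of G,
    so the inclusion factors, up to homology, through a space of finite
    dimension.

    The map r does not preserve the order that orients simplices, so an explicit
    formula for the induced chain map would involve signs of permutations and
    degenerate simplices. Instead the chain map g and the homotopy h are built
    by the method of acyclic carriers ([contiguity_homotopy]): g s is a cone
    over g (bd s) inside the full simplex on r @` s, and h s is a cone over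
    s - g s - h (bd s) inside the full simplex on s `|` r @` s. The only signs to
    check are those of the cone formula [bd_cone]. The construction takes place
    in the augmented chain complex, where the empty set is a simplex of
    dimension -1, because there the cone formula has no exception in dimension
    zero.

    It remains to find r. If L is totally bounded, r moves each point of L to a
    point of a finite (b - a)-net of L; a witness of s at parameter a is a witness
    of s `|` r @` s at parameter b. If W is totally bounded, take a finite
    (b - a)-net F of W: every simplex at parameter a has a witness in F at
    parameter b. Let r send a point l of L to a chosen representative among the
    points that have the same set of elements of F at distance at most b. There
    are finitely many such sets, and l and r l have the same witnesses in F. *)

Set Implicit Arguments.
Unset Strict Implicit.
Unset Printing Implicit Defensive.

Import Order.TTheory GRing.Theory Num.Theory.

Local Open Scope classical_set_scope.
Local Open Scope ring_scope.

(** * Maps of finite rank *)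

Lemma span_coefs (k : fieldType) (V : vectType k) (X : seq V) v :
  v \in <<X>>%VS -> exists c : nat -> k, v = \sum_(i < size X) c i *: X`_i.
Proof.
move=> /(coord_span (X := in_tuple X)) ->.
exists (fun i => oapp (fun j => coord (in_tuple X) j v) 0 (insub i)).
by apply: eq_bigr => i _; rewrite valK.
Qed.

(** Linear maps that vanish on the kernel of a map q into a finite-dimensional
    space: the witnesses are vectors whose images under q span the range of q. *)
Lemma finite_rank_kernel (k : fieldType) (Z U V : lmodType k) n
    (p : {linear Z -> U}) (q : {linear Z -> 'rV[k]_n}) (f : {linear U -> V}) :
  (forall x, exists z, p z = x) -> (forall z, q z = 0 -> f (p z) = 0) ->
  finite_rank f.
Proof.
move=> psurj qf.
pose P m := `[< exists s : seq Z, \dim <<map q s>> = m >].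
have exP : exists m, P m.
  by exists (\dim <<map q [::]>>); apply/asboolP; exists [::].
have ubP m : P m -> (m <= n)%N.
  move=> /asboolP[s <-].
  by rewrite (leq_trans (dimvS (subvf _))) // dimvf /dim /= mul1n.
case: (ex_maxnP exP ubP) => m /asboolP[s dims] maxm {exP ubP}.
(* A list s for which the span of its images has the largest dimension already
   spans every q z. *)
exists (map p s) => x; have [z <-] := psurj x.
have : q z \in <<map q s>>%VS.
  have sub : (<<map q s>> <= <<map q (z :: s)>>)%VS.
    by rewrite /= span_cons addvSr.
  have /eqP -> : <<map q s>>%VS == <<map q (z :: s)>>%VS.
    by rewrite eqEdim sub dims maxm //; apply/asboolP; exists (z :: s).
  by rewrite memv_span // map_f // mem_head.
move=> /span_coefs[c]; rewrite !size_map => qz; exists (fun i => c i).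
pose y := \sum_(i < size s) c i *: s`_i.
have qy : q (z - y) = 0.
  rewrite linearB linear_sum qz; apply/eqP; rewrite subr_eq0; apply/eqP.
  by apply: eq_bigr => i _; rewrite linearZ (nth_map 0).
have := qf _ qy; rewrite !linearB /= => /eqP; rewrite subr_eq0 => /eqP ->.
rewrite !linear_sum; apply: eq_bigr => i _.
by rewrite !linearZ /= (nth_map 0).
Qed.

(** * Linear extension and supports of chains *)

Section Chains.
Variables (k : fieldType) (T : choiceType).
Local Notation chains := {malg k[{fset T}]}.
Implicit Types (s t : {fset T}) (v w : T) (c : chains).

Definition linext (M : lmodType k) (phi : {fset T} -> M) c : M :=
  \sum_(s <- msupp c) c@_s *: phi s.

Section Linext.
Variables (M : lmodType k) (phi : {fset T} -> M).

Lemma linextEw (d : {fset {fset T}}) c :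
  (msupp c `<=` d)%fset -> linext phi c = \sum_(s <- d) c@_s *: phi s.
Proof.
move=> cd; rewrite /linext (big_fset_incl _ cd) //= => s _.
by move/mcoeff_outdom => ->; rewrite scale0r.
Qed.

Lemma linext_is_linear : linear (linext phi).
Proof.
move=> a c1 c2; pose d := (msupp c1 `|` msupp c2)%fset.
have d1 : (msupp c1 `<=` d)%fset by apply: fsubsetUl.
have d2 : (msupp c2 `<=` d)%fset by apply: fsubsetUr.
have d3 : (msupp (a *: c1 + c2) `<=` d)%fset.
  apply: fsubset_trans (msuppD_le _ _) _; rewrite fsubUset d2 andbT.
  exact: fsubset_trans (msuppZ_le _ _) d1.
rewrite (linextEw d1) (linextEw d2) (linextEw d3) scaler_sumr -big_split.
by apply: eq_bigr => s _; rewrite mcoeffD mcoeffZ scalerDl scalerA.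
Qed.

HB.instance Definition _ :=
  GRing.isLinear.Build k chains M _ (linext phi) linext_is_linear.

Lemma linextU a s : linext phi << a *g s >> = a *: phi s.
Proof. by rewrite (linextEw (@msuppU_le _ _ s a)) big_seq_fset1 mcoeffUU. Qed.

End Linext.

Lemma eq_linext (M : lmodType k) (phi psi : {fset T} -> M) c :
  {in msupp c, phi =1 psi} -> linext phi c = linext psi c.
Proof. by move=> e; apply: eq_big_seq => s /e ->. Qed.

Lemma linextB (M : lmodType k) (phi psi : {fset T} -> M) c :
  linext (fun s => phi s - psi s) c = linext phi c - linext psi c.
Proof. by rewrite /linext -sumrB; apply: eq_bigr => s _; rewrite scalerBr. Qed.

Lemma linext_comp (M : lmodType k) (phi : {fset T} -> M)
    (psi : {fset T} -> chains) c :
  linext phi (linext psi c) = linext (fun s => linext phi (psi s)) c.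
Proof. by rewrite linear_sum; apply: eq_bigr => s _; rewrite linearZ. Qed.

Lemma scale_monalgU (a b : k) s : a *: << b *g s >> = << a * b *g s >> :> chains.
Proof. by apply/malgP => t; rewrite mcoeffZ !mcoeffU mulrnAr. Qed.

Lemma linext_id c : linext (fun s => << s >>) c = c.
Proof.
rewrite [RHS]monalgE; apply: eq_bigr => s _.
by rewrite scale_monalgU mulr1.
Qed.

Definition supported (P : set {fset T}) : {pred chains} :=
  fun c => `[< forall s, s \in msupp c -> P s >].

Lemma supportedP P c :
  reflect (forall s, s \in msupp c -> P s) (c \in supported P).
Proof. exact: asboolP. Qed.

Lemma supported_submod_closed P : subsemimod_closed (supported P).
Proof.
split; first split.
- by apply/supportedP => s; rewrite msupp0.
- move=> c1 c2 /supportedP h1 /supportedP h2; apply/supportedP => s.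
  by move=> /(fsubsetP (msuppD_le _ _)); rewrite inE => /orP[/h1|/h2].
- move=> a c /supportedP h; apply/supportedP => s.
  by move=> /(fsubsetP (msuppZ_le _ _)) /h.
Qed.

HB.instance Definition _ P :=
  GRing.isSubmodClosed.Build k chains (supported P) (supported_submod_closed P).

Lemma supportedU (P : set {fset T}) a s : P s -> << a *g s >> \in supported P.
Proof.
move=> Ps; apply/supportedP => t /(fsubsetP msuppU_le).
by rewrite inE => /eqP ->.
Qed.

Lemma supportedS (P Q : set {fset T}) c :
  P `<=` Q -> c \in supported P -> c \in supported Q.
Proof. by move=> PQ /supportedP h; apply/supportedP => s /h/PQ. Qed.

Lemma linext_supported (P Q : set {fset T}) phi c :
  c \in supported P -> (forall s, P s -> phi s \in supported Q) ->
  linext phi c \in supported Q.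
Proof.
move=> /supportedP cP h; rewrite /linext big_seq; apply: rpred_sum => s /cP/h.
exact: rpredZ.
Qed.

(** * The augmented differential and cones *)

(** Contrary to [simplex_boundary], the empty face of a vertex is kept: this is
    the differential of the augmented complex. *)
Definition facets s : chains :=
  \sum_(v <- s) << (-1) ^+ position s v *g (s `\ v)%fset >>.

Local Notation bd := (linext facets).

Lemma facets_supported s :
  facets s \in supported [set t | (t `<=` s)%fset /\ #|` s| = #|` t|.+1].
Proof.
rewrite /facets big_seq; apply: rpred_sum => v vs; apply: supportedU; split.
  exact: fsubD1set.
by rewrite (cardfsD1 v s) vs.
Qed.

(** The sign moves v from the first place of (v, s) to its place in the order of
    vertices. *)
Definition cone_simplex v s : chains :=
  if v \in s then 0 else << (-1) ^+ position (v |` s)%fset v *g (v |` s)%fset >>.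

Local Notation cone v := (linext (cone_simplex v)).

Lemma vertex_lt_total v w : v != w -> vertex_lt v w (+) vertex_lt w v.
Proof.
move=> vw; rewrite /vertex_lt (eq_sym w v) vw /=.
have := (vertex_le_total_order T).2 v w.
case lvw: (vertex_le v w); case lwv: (vertex_le w v) => //= _.
by case/eqP: vw; apply: (vertex_le_total_order T).1.2; rewrite lvw lwv.
Qed.

(** Removing the smaller of two vertices shifts the position of the larger one
    by one, and removing the larger leaves the smaller in place: this is the
    parity behind all cancellations of signs. *)
Lemma position_swap s v w : v \in s -> w \in s -> v != w ->
  (position s v + position s w =
   (position (s `\ v)%fset w + position (s `\ w)%fset v).+1)%N.
Proof.
move=> vs ws /vertex_lt_total; case: (boolP (vertex_lt v w)) => /= vw.
  by rewrite (position_lt vs vw) (position_gt _ vw) addnS addnC.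
by move=> wv; rewrite (position_lt ws wv) (position_gt _ wv) addSn addnC.
Qed.

Lemma bd_cone_simplex v s :
  bd (cone_simplex v s) + cone v (facets s) = << s >>.
Proof.
rewrite /cone_simplex; case: ifP => [vs|/negbT vs].
  rewrite linear0 add0r linear_sum /= (big_fsetD1 v) //= big_seq big1 => [|w].
    rewrite addr0 linextU /cone_simplex !inE eqxx fsetD1K //=.
    by rewrite scale_monalgU -expr2 sqrr_sign.
  rewrite !inE => /andP[wv _].
  by rewrite linextU /cone_simplex !inE eq_sym wv vs scaler0.
have vvs : v \in (v |` s)%fset by rewrite !inE eqxx.
rewrite linextU {1}/facets (big_fsetD1 v) //= fsetU1K // scalerDr.
rewrite -addrA [X in X + _](_ : _ = << s >>); last first.
  by rewrite scale_monalgU -expr2 sqrr_sign.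
rewrite scaler_sumr linear_sum /= -big_split big1_seq ?addr0 // => w /= ws.
have vw : v != w by apply: contraNneq vs => ->.
have E : ((v |` s) `\ w = v |` (s `\ w))%fset.
  by apply/fsetP => u; rewrite !inE; case: (eqVneq u v) => // ->; rewrite vw.
rewrite linextU /cone_simplex !inE (negbTE vs) andbF -E.
have := position_swap vvs _ vw; rewrite !inE ws orbT fsetU1K // => /(_ isT) swap.
rewrite !scale_monalgU -monalgUD -!exprD swap exprS mulN1r addNr.
exact: monalgU0.
Qed.

(** Cones contract the augmented complex, in every dimension and without
    correction term in dimension zero. *)
Lemma bd_cone v c : bd (cone v c) = c - cone v (bd c).
Proof.
apply/(canRL (addrK _)).
rewrite -[RHS]linext_id [cone v (bd c)]linext_comp [bd (cone v c)]linext_comp.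
rewrite /linext -big_split; apply: eq_bigr => s _ /=.
by rewrite -scalerDr -(bd_cone_simplex v s).
Qed.

Lemma cone_supported v s c :
  v \in s -> c \in supported [set t | (t `<=` s)%fset] ->
  cone v c \in supported [set t | (t `<=` s)%fset /\ t != fset0].
Proof.
move=> vs cs; apply: linext_supported cs _ => t /= ts; rewrite /cone_simplex.
case: ifP => _; first exact: rpred0.
apply: supportedU; split; first by rewrite fsubUset fsub1set vs.
by apply/fset0Pn; exists v; rewrite !inE eqxx.
Qed.

(** Recursion on dimension: the value at a simplex may use the linear extension
    of the values at its facets and one chosen vertex, the apex of a cone. *)
Lemma recursion_on_facets (M : lmodType k) (base : M)
    (step : T -> {fset T} -> M -> M) :
  exists phi : {fset T} -> M, phi fset0 = base /\
    forall s, s != fset0 ->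
      exists2 v, v \in s & phi s = step v s (linext phi (facets s)).
Proof.
(* The fuel n is meant to be the cardinality of s. *)
pose fix F n s {struct n} := if n is m.+1 then
  (if enum_fset s is v :: _ then step v s (linext (F m) (facets s)) else base)
  else base.
exists (fun s => F #|` s| s); split=> [|s]; first by rewrite cardfs0.
rewrite -cardfs_gt0; case E: #|` s| => [//|n] _ /=.
case Es: (enum_fset s) => [|v s']; first by move: E; rewrite /= Es.
exists v; first by have := mem_head v s'; rewrite -Es.
congr step; apply: eq_linext => t /(supportedP _ _ (facets_supported s))[_].
by rewrite E => -[<-].
Qed.

Lemma facets_ind (P : {fset T} -> Prop) :
  (forall s, (forall t, t \in msupp (facets s) -> P t) -> P s) -> forall s, P s.
Proof.
move=> step s; move: {2}#|` s| (erefl #|` s|) => n; elim: n s => [|n IH] s sn;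
  apply: step => t /(supportedP _ _ (facets_supported s))[_]; rewrite sn //.
by move=> [/esym]; apply: IH.
Qed.

Lemma facets0 : facets fset0 = 0.
Proof. by rewrite /facets big_seq_fset0. Qed.

(** Induction along v |` s: up to sign this simplex is the cone over s, and the
    cone formula reduces its double boundary to that of s. *)
Lemma bd_facets s : bd (facets s) = 0.
Proof.
suff step v t :
    v \notin t -> bd (facets t) = 0 -> bd (facets (v |` t)%fset) = 0.
  by elim/fset1U_rect: s => [|v t]; [rewrite facets0 linear0 | apply: step].
move=> vt IH; have : bd (bd (cone_simplex v t)) = 0.
  have -> : bd (cone_simplex v t) = << t >> - cone v (facets t).
    by rewrite -(bd_cone_simplex v t) addrK.
  by rewrite linearB /= bd_cone IH linear0 subr0 linextU scale1r subrr.
rewrite /cone_simplex (negbTE vt) linextU linearZ /= => /eqP.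
by rewrite scaler_eq0 signr_eq0 => /eqP.
Qed.

(** * Contiguous maps are homotopic *)

(** Acyclic carriers: full simplices are acyclic by [bd_cone], so g and h can be
    chosen on one simplex after the other, with g s carried by r @` s and h s by
    s `|` r @` s. The value h fset0 = 0 is what allows the homotopy formula to
    descend to the complex without augmentation. *)
Lemma contiguity_homotopy (r : T -> T) : exists g h : {fset T} -> chains,
  [/\ forall s, s != fset0 ->
        g s \in supported [set t | (t `<=` r @` s)%fset /\ t != fset0],
      forall s, s != fset0 ->
        h s \in supported [set t | (t `<=` s `|` r @` s)%fset /\ t != fset0],
      h fset0 = 0 &
      forall c, bd (linext h c) = c - linext g c - linext h (bd c)].
Proof.
have [g [g0 gS]] :=
  recursion_on_facets << fset0 >> (fun v _ x => cone (r v) x).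
have [h [h0 hS]] :=
  recursion_on_facets 0 (fun v s x => cone v (<< s >> - g s - x)).
have supp_g s : g s \in supported
    [set t | (t `<=` r @` s)%fset /\ (s != fset0 -> t != fset0)].
  elim/facets_ind: s => s IH; have [->|s0] := eqVneq s fset0.
    by rewrite g0; apply: supportedU; split; [exact: fsub0set | case/eqP].
  have [v vs ->] := gS _ s0.
  apply: (@supportedS [set t | (t `<=` r @` s)%fset /\ t != fset0]).
    by move=> t [].
  apply: cone_supported; first exact: in_imfset.
  apply: (@linext_supported [set t | t \in msupp (facets s)]).
    exact/supportedP.
  move=> t ts; apply: supportedS (IH t ts) => u [/= ur _].
  apply: fsubset_trans ur _; apply: subset_imfset => x; apply/fsubsetP.
  by have [] := supportedP _ _ (facets_supported s) _ ts.
have g_supp s : s != fset0 ->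
    g s \in supported [set t | (t `<=` r @` s)%fset /\ t != fset0].
  by move=> s0; apply: supportedS (supp_g s) => t [tr /(_ s0)].
have supp_h s : h s \in supported
    [set t | (t `<=` s `|` r @` s)%fset /\ t != fset0].
  elim/facets_ind: s => s IH; have [->|s0] := eqVneq s fset0.
    by rewrite h0 rpred0.
  have [v vs ->] := hS _ s0.
  apply: cone_supported; first by rewrite inE vs.
  apply: rpredB; first apply: rpredB.
  - by apply: supportedU; apply: fsubsetUl.
  - apply: supportedS (supp_g s) => t [tr _] /=.
    exact: fsubset_trans tr (fsubsetUr _ _).
  apply: (@linext_supported [set t | t \in msupp (facets s)]).
    exact/supportedP.
  move=> t ts; apply: supportedS (IH t ts) => u [/= ur _].
  have [/= tsub _] := supportedP _ _ (facets_supported s) _ ts.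
  apply: fsubset_trans ur _; apply: fsetUSS => //.
  by apply: subset_imfset => x; apply/fsubsetP.
have bdg s : bd (g s) = linext g (facets s).
  elim/facets_ind: s => s IH; have [->|s0] := eqVneq s fset0.
    by rewrite g0 linextU scale1r facets0 linear0.
  have [v vs ->] := gS _ s0; rewrite bd_cone.
  have -> : bd (linext g (facets s)) = linext g (bd (facets s)).
    rewrite (linext_comp facets g (facets s)).
    by rewrite (linext_comp g facets (facets s)); apply: eq_linext.
  by rewrite bd_facets !linear0 addr0.
have homotopy c :
    {in msupp c, forall s, bd (h s) = << s >> - g s - linext h (facets s)} ->
    bd (linext h c) = c - linext g c - linext h (bd c).
  move=> hc; rewrite (linext_comp facets h c) (linext_comp h facets c).
  by rewrite (eq_linext hc) !linextB linext_id.
have bdh s : bd (h s) = << s >> - g s - linext h (facets s).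
  elim/facets_ind: s => s IH; have [->|s0] := eqVneq s fset0.
    by rewrite h0 g0 facets0 !linear0 subrr addr0.
  have [v vs ->] := hS _ s0; rewrite bd_cone.
  have -> : bd (<< s >> - g s - linext h (facets s)) = 0.
    (* By induction bd (h (bd s)) = bd s - g (bd s), as bd (bd s) = 0. *)
    rewrite linearB linearB /= bdg linextU scale1r (homotopy _ IH) bd_facets.
    by rewrite linear0 subr0 subrr.
  by rewrite linear0 subr0.
by exists g, h; split => // c; apply: homotopy => s _; apply: bdh.
Qed.

(** * Finite rank on homology *)

Definition nonempty_part s : chains := if s == fset0 then 0 else << s >>.

Local Notation deaugment := (linext nonempty_part).

(** Passage from the augmented differential to [boundary], for which the empty
    set carries no chain. *)
Lemma deaugment_bd c : boundary c = deaugment (bd c).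
Proof.
rewrite linext_comp; apply: eq_bigr => s _; congr (_ *: _).
rewrite /= /facets linear_sum /simplex_boundary big_mkcond; apply: eq_bigr => v _.
rewrite /= linextU /nonempty_part; case: eqP => _ /=.
  by rewrite scaler0.
by rewrite scale_monalgU mulr1.
Qed.

Lemma deaugment_id c : c \in supported [set t | t != fset0] -> deaugment c = c.
Proof.
move=> /supportedP c0; rewrite -[RHS]linext_id; apply: eq_linext => s /c0.
by rewrite /nonempty_part => /negbTE ->.
Qed.

Lemma linext_deaugment (M : lmodType k) (phi : {fset T} -> M) c :
  phi fset0 = 0 -> linext phi (deaugment c) = linext phi c.
Proof.
move=> phi0; rewrite (linext_comp phi nonempty_part c).
apply: eq_linext => s _ /=; rewrite /nonempty_part.
by case: eqP => [->|_]; rewrite ?linear0 // linextU scale1r.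
Qed.

Definition coefficients (d : seq {fset T}) c : 'rV[k]_(size d) :=
  \row_i c@_(nth fset0 d i).

Lemma coefficients_is_linear d : linear (coefficients d).
Proof. by move=> a c1 c2; apply/rowP => i; rewrite !mxE mcoeffD mcoeffZ. Qed.

HB.instance Definition _ d := GRing.isLinear.Build k chains 'rV[k]_(size d) _
  (coefficients d) (coefficients_is_linear d).

Lemma coefficients_eq0 (d : seq {fset T}) c :
  c \in supported [set t | t \in d] -> coefficients d c = 0 -> c = 0.
Proof.
move=> /supportedP cd /rowP c0; apply/malgP => s; rewrite mcoeff0.
case: (msuppP c s) => // /cd /= sd.
have := c0 (Ordinal (etrans (index_mem s d) sd)).
by rewrite !mxE /= nth_index.
Qed.

(** A cycle z with g z = 0 is the boundary of h z, and g takes values in the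
    chains on the subsets of the finite set G. *)
Lemma finite_rank_contiguous (K K' : simplicial_complex T)
    (sKK' : simplices K `<=` simplices K') (r : T -> T) (G : {fset T}) :
  (forall s, simplices K s -> (r @` s `<=` G)%fset) ->
  (forall s, simplices K s -> simplices K' (s `|` r @` s)%fset) ->
  finite_rank (homology_incl k sKK').
Proof.
move=> rG rK; have [g [h [gs hs h0 hg]]] := contiguity_homotopy r.
pose d : seq {fset T} := fpowerset G.
apply: (@finite_rank_kernel k (cycles k K) _ _ _ (@homology_class k T K)
  (coefficients d \o linext g \o (\val : cycles k K -> chains))).
  by move=> x; exists (repr x); apply: homology_class_repr.
move=> z /= gz0; have /andP[/chainP zK /eqP bz] := valP z.
have {}gz0 : linext g (val z) = 0.
  apply: coefficients_eq0 gz0; apply: (@linext_supported (simplices K)).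
    exact/supportedP.
  move=> s Ks; apply: supportedS (gs s (simplex_neq0 Ks)) => t [tr _] /=.
  by rewrite fpowersetE (fsubset_trans tr) // rG.
have bhz : bd (linext h (val z)) = val z.
  rewrite hg gz0 subr0 -(linext_deaugment _ h0) -deaugment_bd bz linear0.
  exact: subr0.
rewrite homology_inclE -(linear0 (@homology_class k T K')).
apply/homology_classP/boundariesP; rewrite subr0; exists (linext h (val z)).
  suff : linext h (val z) \in supported (simplices K').
    by move=> /supportedP ?; apply/chainP.
  apply: (@linext_supported (simplices K)); first exact/supportedP.
  move=> s Ks; apply: supportedS (hs s (simplex_neq0 Ks)) => t [ts t0].
  exact: simplex_face (rK s Ks) ts t0.
rewrite deaugment_bd bhz deaugment_id //; apply/supportedP => s /zK.
exact: simplex_neq0.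
Qed.

End Chains.

(** * Čech complexes *)

Section Cech.
Variables (R : realType) (k : fieldType) (X : metricType R) (L W : set X).

(** The form of contiguity shared by both cases: each witness w at parameter a is
    replaced by a witness w' at parameter b, uniformly in the simplex, that also
    sees the images under r. *)
Lemma cech_finite_rank (r : X -> X) (G : {fset X}) (a b : R) (h : a <= b) :
  (forall l, L l -> r l \in G /\ L (r l)) ->
  (forall w, W w -> exists2 w', W w' &
     forall l, L l -> mdist w l <= a -> mdist w' l <= b /\ mdist w' (r l) <= b) ->
  finite_rank (pm_map (cech_persistence k L W) h).
Proof.
move=> rL rW; apply: (@finite_rank_contiguous _ _ _ _ _ r G).
  by move=> s [_ sL _]; apply/fsubsetP => _ /imfsetP[l /= /sL/rL[rlG _] ->].
move=> s [s0 sL [w Ww ws]]; split.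
- rewrite -cardfs_gt0 (leq_trans _ (fsubset_leq_card (fsubsetUl _ _))) //.
  by rewrite cardfs_gt0.
- by move=> _ /fsetUP[/sL //|/imfsetP[l /= /sL/rL[_ ?] ->]].
have [w' Ww' w'P] := rW w Ww; exists w' => // l'.
by move=> /fsetUP[ls|/imfsetP[l /= ls ->]]; have [] := w'P _ (sL _ ls) (ws _ ls).
Qed.

(** Each point of L moves by less than b - a into a finite net of L, so by the
    triangle inequality witnesses need not move. *)
Lemma q_tame_totally_bounded_vertices :
  totally_bounded L -> q_tame (cech_persistence k L W).
Proof.
move=> Lb a b ab; have e0 : 0 < b - a by rewrite subr_gt0.
have [F [Ffin FL Fnet]] := Lb _ e0.
have [x|r rP] := @choice X X (fun x y => L x -> F y /\ mdist x y < b - a).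
  have [Lx|nLx] := pselect (L x); last by exists x.
  by have [y Fy xy] := Fnet x Lx; exists y.
apply: (@cech_finite_rank r (fset_set F)) => [l /rP[Fr _]|w Ww].
  by split; [rewrite in_fset_set // inE | apply: FL].
exists w => // l /rP[_ lr] wl; split; first exact: le_trans wl (ltW ab).
apply: le_trans (metric_triangle _ l _) _.
by rewrite -(subrKC a b) lerD // ltW.
Qed.

(** Witnesses move into a finite net F of W, and r identifies the points of L
    that are close to the same elements of F. *)
Lemma q_tame_totally_bounded_witnesses :
  totally_bounded W -> q_tame (cech_persistence k L W).
Proof.
move=> Wb a b ab; have e0 : 0 < b - a by rewrite subr_gt0.
have [F [Ffin FW Fnet]] := Wb _ e0.
pose near_set l := [fset w in fset_set F | mdist w l <= b]%fset.
(* The representative depends on the set t = near_set l alone, which makes the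
   image of r finite; sets that no point of L realizes are sent to None. *)
have [t|rep repP] := @choice {fset X} (option X) (fun t o =>
    forall l, L l -> near_set l = t ->
    exists y, [/\ o = Some y, L y & near_set y = t]).
  have [[y [Ly yt]]|no] := pselect (exists y, L y /\ near_set y = t).
    by exists (Some y) => l _ _; exists y.
  by exists None => l Ll lt; case: no; exists l.
pose r l := odflt l (rep (near_set l)).
have rP l : L l ->
    [/\ rep (near_set l) = Some (r l), L (r l) & near_set (r l) = near_set l].
  by move=> Ll; have [y [e Ly yl]] := repP _ l Ll erefl; rewrite /r e.
apply: (@cech_finite_rank r [fset x in pmap rep (fpowerset (fset_set F))]%fset).
  move=> l Ll; have [e Lr _] := rP l Ll; split => //.
  rewrite !inE mem_pmap; apply/mapP; exists (near_set l) => //.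
  by rewrite fpowersetE; apply: fset_sub.
move=> w Ww; have [w' Fw' ww'] := Fnet w Ww; exists w'; first exact: FW.
move=> l Ll wl; have w'l : mdist w' l <= b.
  apply: le_trans (metric_triangle _ w _) _.
  by rewrite -(subrK a b) lerD // metric_sym ltW.
split => //; have [_ _ same] := rP l Ll.
have : w' \in near_set l.
  rewrite !inE in_fset_set //. by rewrite mem_set.
by rewrite -same !inE => /andP[].
Qed.

End Cech.

Theorem proposition5p4 (R : realType) (k : fieldType) (X : metricType R)
    (L W : set X) :
  totally_bounded L \/ totally_bounded W -> q_tame (cech_persistence k L W).
Proof.
case; first exact: q_tame_totally_bounded_vertices.
exact: q_tame_totally_bounded_witnesses.
Qed.
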